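(* For any semiring $S$, the following statements are equivalent: (1) $S$ is a right congruence-semisimple semiring; (2) $S \cong M_{n_1}(\mathbb{B}) \times \cdots \times M_{n_k}(\mathbb{B}) \times M_{m_1}(D_1) \times \cdots \times M_{m_r}(D_r)$ (as semirings), where $\mathbb{B}$ is the Boolean semifield, $D_1, \dots, D_r$ are division rings, $k \ge 0$, $r \ge 0$, and $n_i$ ($i = 1, \dots, k$) and $m_j$ ($j = 1, \dots, r$) are positive integers; (3) $S$ is a left congruence-semisimple semiring.
   Context: A semiring $(S,+,\cdot,0,1)$ consists of a commutative monoid $(S,+,0)$ and a monoid $(S,\cdot,1)$ such that multiplication distributes over addition on both sides and $0s=0=s0$ for all $s$. A right $S$-semimodule is a commutative monoid $(M,+,0_M)$ with a scalar multiplication $M\times S\to M$ satisfying $m(ss')=(ms)s'$, $(m+m')s=ms+m's$, $m(s+s')=ms+ms'$, $m1=m$, $0_Ms=0_M=m0$; left semimodules are defined symmetrically. A right (left) ideal of $S$ is a subsemimodule of $S$ regarded as a right (left) semimodule over itself. A congruence on a semimodule is an equivalence relation compatible with addition and scalar multiplication. A nonzero semimodule $M$ is congruence-simple if its only congruences are the identity congruence $\{(m,m)\mid m\in M\}$ and the universal congruence $M\times M$; a right (left) ideal is congruence-simple if it is so as a right (left) $S$-semimodule. A semiring $S$ is right (left) congruence-semisimple if $S$ is a direct sum of congruence-simple right (left) ideals (i.e. each element of $S$ is uniquely a finite sum of elements of these ideals). The Boolean semifield is $\mathbb{B}=(\{0,1\},\max,\min,0,1)$, and $M_n(K)$ is the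 semiring of $n\times n$ matrices over $K$. *)

(* Defs.v *)
From HB Require Import structures.
From mathcomp Require Import all_boot all_order all_algebra.
From mathcomp Require Import finmap.

Set Implicit Arguments.
Unset Strict Implicit.
Unset Printing Implicit Defensive.

Import GRing.Theory.
Local Open Scope ring_scope.

(* [bool] itself carries MathComp's field structure of F_2, so the Boolean
   semifield lives on an alias: [orb] and [andb] are max and min on {0, 1}. *)
Definition boolean_semifield : Type := bool.

HB.instance Definition _ := Choice.on boolean_semifield.
HB.instance Definition _ :=
  GRing.isNmodule.Build boolean_semifield orbA orbC orFb.
HB.instance Definition _ :=
  GRing.Nmodule_isPzSemiRing.Build boolean_semifield
    andbA andTb andbT andb_orl andb_orr andFb andbF.

Definition division_ring (D : unitRingType) : Prop := GRing.field_axiom D.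

Section ProductSemiring.
Variables (I : finType) (R : I -> pzSemiRingType).

Definition prod_semiring : Type := {dffun forall i, R i}.
HB.instance Definition _ := Choice.on prod_semiring.

Implicit Types x y z : prod_semiring.

Definition prod_zero : prod_semiring := [ffun i => 0 : R i].
Definition prod_one : prod_semiring := [ffun i => 1 : R i].
Definition prod_add x y : prod_semiring := [ffun i => x i + y i : R i].
Definition prod_mul x y : prod_semiring := [ffun i => x i * y i : R i].

Lemma prod_addA : associative prod_add.
Proof. by move=> x y z; apply/ffunP => i; rewrite !ffunE addrA. Qed.
Lemma prod_addC : commutative prod_add.
Proof. by move=> x y; apply/ffunP => i; rewrite !ffunE addrC. Qed.
Lemma prod_add0 : left_id prod_zero prod_add.
Proof. by move=> x; apply/ffunP => i; rewrite !ffunE add0r. Qed.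
HB.instance Definition _ :=
  GRing.isNmodule.Build prod_semiring prod_addA prod_addC prod_add0.

Lemma prod_mulA : associative prod_mul.
Proof. by move=> x y z; apply/ffunP => i; rewrite !ffunE mulrA. Qed.
Lemma prod_mul1l : left_id prod_one prod_mul.
Proof. by move=> x; apply/ffunP => i; rewrite !ffunE mul1r. Qed.
Lemma prod_mul1r : right_id prod_one prod_mul.
Proof. by move=> x; apply/ffunP => i; rewrite !ffunE mulr1. Qed.
Lemma prod_mulDl : left_distributive prod_mul prod_add.
Proof. by move=> x y z; apply/ffunP => i; rewrite !ffunE mulrDl. Qed.
Lemma prod_mulDr : right_distributive prod_mul prod_add.
Proof. by move=> x y z; apply/ffunP => i; rewrite !ffunE mulrDr. Qed.
Lemma prod_mul0l : left_zero prod_zero prod_mul.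
Proof. by move=> x; apply/ffunP => i; rewrite !ffunE mul0r. Qed.
Lemma prod_mul0r : right_zero prod_zero prod_mul.
Proof. by move=> x; apply/ffunP => i; rewrite !ffunE mulr0. Qed.
HB.instance Definition _ :=
  GRing.Nmodule_isPzSemiRing.Build prod_semiring prod_mulA prod_mul1l
    prod_mul1r prod_mulDl prod_mulDr prod_mul0l prod_mul0r.

End ProductSemiring.

Definition semiring_isomorphic (R S : pzSemiRingType) : Prop :=
  exists f : {rmorphism R -> S}, bijective f.

Section Subsemimodule.
Variables (R : pzSemiRingType) (M : lSemiModType R) (N : submodClosed M).

Definition subsemimodule : Type := {x : M | x \in N}.
HB.instance Definition _ := SubChoice.on subsemimodule.
HB.instance Definition _ :=
  [SubChoice_isSubLSemiModule of subsemimodule by <:].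

End Subsemimodule.

Section Congruences.
Variables (R : pzSemiRingType) (M : lSemiModType R).

Record congruence (E : M -> M -> Prop) : Prop := Congruence {
  congr_refl : forall x, E x x;
  congr_sym : forall x y, E x y -> E y x;
  congr_trans : forall x y z, E x y -> E y z -> E x z;
  congr_add : forall x y x' y', E x y -> E x' y' -> E (x + x') (y + y');
  congr_scale : forall (a : R) x y, E x y -> E (a *: x) (a *: y)
}.

Definition congruence_simple : Prop :=
  (exists x : M, x != 0) /\
  forall E : M -> M -> Prop, congruence E ->
    (forall x y, E x y <-> x = y) \/ (forall x y, E x y).

End Congruences.

Definition direct_sum (R : pzSemiRingType) (M : lSemiModType R)
    (J : choiceType) (N : J -> submodClosed M) : Prop :=
  forall x : M, exists! f : {fsfun J -> M with 0},
    (forall j, f j \in N j) /\ x = \sum_(j <- finsupp f) f j.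

Definition congruence_semisimple (R : pzSemiRingType) (M : lSemiModType R) :
    Prop :=
  exists (J : choiceType) (N : J -> submodClosed M),
    (forall j, congruence_simple (subsemimodule (N j))) /\ direct_sum N.

(* [S^o] is [S] as a left semimodule over itself. A right [S]-semimodule is a
   left semimodule over the opposite semiring [S^c]; in [(S^c)^o] the scaling
   [a *: x] is [x * a], so its subsemimodules are the right ideals of [S]. *)
Definition left_congruence_semisimple (S : pzSemiRingType) : Prop :=
  congruence_semisimple (S^o : lSemiModType S).
Definition right_congruence_semisimple (S : pzSemiRingType) : Prop :=
  congruence_semisimple ((S^c)^o : lSemiModType S^c).

(* Main.v *)
(* If [S] is a direct sum of congruence-simple left ideals, the components of
   [1] are orthogonal idempotents [e_i], and the summands are the [S e_i].
   Congruence-simplicity is applied to four congruences: the kernel of right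
   multiplication by [a] in [e_i S e_j], the Bourne congruence of [S a],
   translation by additively invertible elements, and equality of annihilators.
   The third one shows that [S e_i] is a group or zero-sum-free; in the latter
   case annihilators separate points, so [e_i S e_i = {0, e_i}].  The first two
   then show that every nonzero element of [e_i S e_j] is invertible.  Such a
   "division frame" is a left-right symmetric notion.  It splits [S] into
   matrix semirings over the corners [e_i S e_i], one for each class of linked
   indices, and it makes every [S e_i] congruence-simple. *)
Require Import Defs.
From HB Require Import structures.
From mathcomp Require Import all_boot all_order all_algebra.
From mathcomp Require Import finmap boolp.

Set Implicit Arguments.
Unset Strict Implicit.
Unset Printing Implicit Defensive.

Import GRing.Theory.
Local Open Scope ring_scope.

(** * Isomorphisms of semirings *)

Lemma semiring_isomorphicI (R S : pzSemiRingType) (f : R -> S) :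
    f 0 = 0 -> f 1 = 1 -> {morph f : x y / x + y} -> {morph f : x y / x * y} ->
    injective f -> (forall y, exists x, f x = y) ->
  semiring_isomorphic R S.
Proof.
move=> f0 f1 fD fM f_inj f_surj.
pose fA := GRing.isNmodMorphism.Build R S f (conj f0 fD).
pose fP := GRing.isMonoidMorphism.Build R S f (conj f1 fM).
pose F : {rmorphism R -> S} := HB.pack f fA fP.
have surj' y : exists x, f x == y by have [x <-] := f_surj y; exists x.
exists F, (fun y => xchoose (surj' y)) => [x | y] /=.
- by apply: f_inj; apply/eqP; exact: (xchooseP (surj' (f x))).
- by apply/eqP; exact: (xchooseP (surj' y)).
Qed.

Lemma semiring_isomorphic_sym (R S : pzSemiRingType) :
  semiring_isomorphic R S -> semiring_isomorphic S R.
Proof.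
move=> [f [g fK gK]].
have f_inj := can_inj fK.
apply: (@semiring_isomorphicI _ _ g) => [| | x y | x y | | y].
- by apply: f_inj; rewrite gK rmorph0.
- by apply: f_inj; rewrite gK rmorph1.
- by apply: f_inj; rewrite rmorphD !gK.
- by apply: f_inj; rewrite rmorphM !gK.
- exact: can_inj gK.
- by exists (f y).
Qed.

Lemma semiring_isomorphic_trans (R S T : pzSemiRingType) :
  semiring_isomorphic R S -> semiring_isomorphic S T -> semiring_isomorphic R T.
Proof. by move=> [f bf] [g bg]; exists (g \o f); apply: bij_comp. Qed.

Lemma semiring_isomorphic_mx (R S : pzSemiRingType) n :
  semiring_isomorphic R S -> semiring_isomorphic 'M[R]_n 'M[S]_n.
Proof.
move=> [f [g fK gK]]; exists (map_mx f : {rmorphism _ -> _}), (map_mx g).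
- by move=> A; apply/matrixP=> i j; rewrite !mxE fK.
- by move=> A; apply/matrixP=> i j; rewrite !mxE gK.
Qed.

Lemma semiring_isomorphic_prod (C I J : finType) (h : I + J -> C)
    (R : C -> pzSemiRingType) (P : I -> pzSemiRingType)
    (Q : J -> pzSemiRingType) :
    bijective h ->
    (forall i, semiring_isomorphic (R (h (inl i))) (P i)) ->
    (forall j, semiring_isomorphic (R (h (inr j))) (Q j)) ->
  semiring_isomorphic (prod_semiring R) (prod_semiring P * prod_semiring Q)%type.
Proof.
move=> [k hK kK] isoP isoQ.
pose f i := sval (cid (isoP i)); pose g j := sval (cid (isoQ j)).
have f_bij i : bijective (f i) by exact: svalP (cid (isoP i)).
have g_bij j : bijective (g j) by exact: svalP (cid (isoQ j)).
pose F (x : prod_semiring R) : prod_semiring P * prod_semiring Q :=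
  ([ffun i => f i (x (h (inl i)))], [ffun j => g j (x (h (inr j)))]).
apply: (@semiring_isomorphicI _ _ F) => [| | x y | x y | x y [] | [y z]].
- by congr pair; apply/ffunP=> i; rewrite !ffunE rmorph0.
- by congr pair; apply/ffunP=> i; rewrite !ffunE rmorph1.
- by congr pair; apply/ffunP=> i; rewrite !ffunE rmorphD.
- by congr pair; apply/ffunP=> i; rewrite !ffunE rmorphM.
- move=> /ffunP fE /ffunP gE; apply/ffunP=> c; rewrite -(kK c).
  case: (k c) => i; [have := fE i | have := gE i]; rewrite !ffunE.
    exact/bij_inj/f_bij.
  exact/bij_inj/g_bij.
(* The component at [c] must live in [R c], while [y] and [z] prescribe values over the [s] with
   [h s = c]. Quantifying over all such [s] and casting keeps this well typed; [s] is unique because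
   [h] is injective, and [eq_axiomK] erases the cast. *)
- have E c : {t : R c | forall s (e : h s = c),
      match s return R (h s) -> Prop with
      | inl i => fun u => f i u = y i | inr j => fun u => g j u = z j
      end (ecast c (R c) (esym e) t)}.
    apply: cid; rewrite -(kK c); case: (k c) => i.
      have [f' _ fK'] := f_bij i; exists (f' (y i)) => s e.
      have es : s = inl i by apply: (can_inj hK).
      by subst s; rewrite (eq_axiomK e) /=.
    have [g' _ gK'] := g_bij i; exists (g' (z i)) => s e.
    have es : s = inr i by apply: (can_inj hK).
    by subst s; rewrite (eq_axiomK e) /=.
  exists [ffun c => sval (E c)]; congr pair; apply/ffunP=> i; rewrite !ffunE.
    exact: (svalP (E (h (inl i))) _ erefl).
  exact: (svalP (E (h (inr i))) _ erefl).
Qed.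

(** * Division frames *)

(** For [i = j], [frame_inv] makes the corner at [e i] a division semiring; for [i != j], it turns
    any nonzero element between [e i] and [e j] into an isomorphism of these idempotents.
    [frame_corner] says that each corner is a ring or the two-element Boolean one. *)
Record division_frame (S : pzSemiRingType) (T : finType) (e : T -> S) : Prop :=
  DivisionFrame {
    frame_neq0 : forall i, e i != 0;
    frame_mul : forall i j, e i * e j = if i == j then e i else 0;
    frame_sum : \sum_i e i = 1;
    frame_inv : forall i j x, e i * x * e j != 0 ->
      exists t, t * (e i * x * e j) = e j /\ e i * x * e j * t = e i;
    frame_corner : forall i, (exists x, e i + x = 0) \/
      e i + e i = e i /\ forall x, e i * x * e i = 0 \/ e i * x * e i = e i
  }.

Definition has_division_frame (S : pzSemiRingType) : Prop :=
  exists (T : finType) (e : T -> S), division_frame e.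

Lemma has_division_frame_converse (S : pzSemiRingType) :
  has_division_frame S -> has_division_frame S^c.
Proof.
move=> [T [e [e0 eM e1 eV eC]]]; exists T, (e : T -> S^c); split=> //.
- by move=> i j; rewrite [LHS](eM j i) eq_sym; case: eqP => [->|].
- move=> i j x nz; have /eV[t [t1 t2]] : e j * x * e i != 0 by rewrite -mulrA.
  by exists t; split; rewrite -mulrA in t1 t2.
- move=> i; have [?|[ee ex]] := eC i; [by left | right; split=> // x].
  by have := ex x; rewrite -mulrA.
Qed.

Lemma has_division_frame_iso (R S : pzSemiRingType) :
  semiring_isomorphic R S -> has_division_frame R -> has_division_frame S.
Proof.
move=> [f [g fK gK]] [T [e [e0 eM e1 eV eC]]]; exists T, (f \o e).
have f_inj := can_inj fK.
have f_eq0 x : (f x == 0) = (x == 0) by rewrite -(rmorph0 f) (inj_eq f_inj).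
split=> /= [i | i j | | i j x | i].
- by rewrite f_eq0.
- by rewrite -rmorphM eM; case: ifP => // _; rewrite rmorph0.
- by rewrite -rmorph_sum e1 rmorph1.
- rewrite -(gK x) -!rmorphM f_eq0 => /eV[t [t1 t2]].
  by exists (f t); rewrite -!rmorphM t1 t2.
- case: (eC i) => [[x ex]|[ee ex]]; [left | right].
    by exists (f x); rewrite -rmorphD ex rmorph0.
  rewrite -rmorphD ee; split=> // x; rewrite -(gK x) -!rmorphM.
  by case: (ex (g x)) => ->; [left; rewrite rmorph0 | right].
Qed.

Lemma has_division_frame_pair (R S : pzSemiRingType) :
  has_division_frame R -> has_division_frame S ->
  has_division_frame (R * S)%type.
Proof.
move=> [I [e [e0 eM e1 eV eC]]] [J [f [f0 fM f1 fV fC]]].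
exists (I + J)%type, (fun k => match k with
  inl i => (e i, 0) | inr j => (0, f j) end).
have pM (a b : R) (c d : S) : (a, c) * (b, d) = (a * b, c * d) by [].
have pD (a b : R) (c d : S) : (a, c) + (b, d) = (a + b, c + d) by [].
have pE (a : R) (c : S) : ((a, c) == 0 :> R * S) = (a == 0) && (c == 0) by [].
split=> [[] i | [] i [] j | | [] i [] j [x y] | [] i].
- by rewrite pE negb_and e0.
- by rewrite pE negb_and f0 orbT.
- rewrite pM eM mulr0 (_ : (inl i == inl j) = (i == j)) //.
  by case: ifP.
- by rewrite pM mulr0 mul0r.
- by rewrite pM mulr0 mul0r.
- rewrite pM fM mulr0 (_ : (inr i == inr j) = (i == j)) //.
  by case: ifP.
- rewrite big_sumType /=.
  have -> : \sum_i (e i, 0 : S) = (1, 0).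
    rewrite -e1; elim/big_ind2: _ => // a b c d -> ->; by rewrite pD addr0.
  have -> : \sum_j (0 : R, f j) = (0, 1).
    rewrite -f1; elim/big_ind2: _ => // a b c d -> ->; by rewrite pD addr0.
  by rewrite pD addr0 add0r.
- rewrite !pM !(mulr0, mul0r) pE eqxx andbT => /eV[t [t1 t2]].
  by exists (t, 0); rewrite !pM t1 t2 !mulr0.
- by rewrite !pM !(mulr0, mul0r) eqxx.
- by rewrite !pM !(mulr0, mul0r) eqxx.
- rewrite !pM !(mulr0, mul0r) pE eqxx => /fV[t [t1 t2]].
  by exists (0, t); rewrite !pM t1 t2 !mulr0.
- case: (eC i) => [[x ex]|[ee ex]]; [left | right].
    by exists (x, 0); rewrite pD ex addr0.
  rewrite pD ee addr0; split=> // -[x y]; rewrite !pM !mul0r.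
  by case: (ex x) => ->; [left | right].
- case: (fC i) => [[x ex]|[ee ex]]; [left | right].
    by exists (0, x); rewrite pD ex addr0.
  rewrite pD ee addr0; split=> // -[x y]; rewrite !pM !mul0r.
  by case: (ex y) => ->; [left | right].
Qed.

(** * Frames of finite products *)

Section ProductInjection.
Variables (I : finType) (R : I -> pzSemiRingType).

Definition prod_inj i (x : R i) : prod_semiring R :=
  [ffun j => dfwith (fun k => 0 : R k) x j].

Lemma prod_inj_in i (x : R i) : prod_inj x i = x.
Proof. by rewrite ffunE dfwith_in. Qed.

Lemma prod_inj_out i j (x : R i) : i != j -> prod_inj x j = 0.
Proof. by move=> ij; rewrite ffunE dfwith_out. Qed.

Lemma prod_inj0 i : prod_inj (0 : R i) = 0.
Proof.
apply/ffunP=> j; have [<-|ij] := eqVneq i j.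
  by rewrite prod_inj_in ffunE.
by rewrite prod_inj_out // ffunE.
Qed.

Lemma prod_inj_eq0 i (x : R i) : (prod_inj x == 0) = (x == 0).
Proof.
apply/eqP/eqP => [/ffunP/(_ i)|->]; last exact: prod_inj0.
by rewrite prod_inj_in ffunE.
Qed.

Lemma prod_injD i : {morph @prod_inj i : x y / x + y}.
Proof.
move=> x y; apply/ffunP=> j; rewrite [RHS]ffunE; have [<-|ij] := eqVneq i j.
  by rewrite !prod_inj_in.
by rewrite !prod_inj_out // addr0.
Qed.

Lemma prod_inj_mulr i (x : R i) (y : prod_semiring R) :
  prod_inj x * y = prod_inj (x * y i).
Proof.
apply/ffunP=> j; rewrite [LHS]ffunE; have [<-|ij] := eqVneq i j.
  by rewrite !prod_inj_in.
by rewrite !prod_inj_out // mul0r.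
Qed.

Lemma sum_prod_inj (x : prod_semiring R) : \sum_i prod_inj (x i) = x.
Proof.
apply/ffunP=> j.
have evD (y z : prod_semiring R) : (y + z) j = y j + z j by rewrite ffunE.
rewrite (big_morph (fun y : prod_semiring R => y j) evD (ffunE _ _)).
rewrite (bigD1 j) //= prod_inj_in big1 ?addr0 // => i ij.
by rewrite prod_inj_out.
Qed.

End ProductInjection.

Lemma has_division_frame_prod (I : finType) (R : I -> pzSemiRingType) :
  (forall i, has_division_frame (R i)) -> has_division_frame (prod_semiring R).
Proof.
move=> frR; pose T i := sval (cid (frR i)).
have frT i : exists e : T i -> R i, division_frame e.
  exact: svalP (cid (frR i)).
pose e i := sval (cid (frT i)).
have fr i : division_frame (e i) := svalP (cid (frT i)).
exists {i & T i}, (fun k => prod_inj (e (tag k) (tagged k))).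
split=> [[i k] | [i k] [j l] | | [i k] [j l] x | [i k]] /=.
- by rewrite prod_inj_eq0 frame_neq0.
- rewrite prod_inj_mulr; have [ij|ij] := eqVneq i j.
    subst j; rewrite prod_inj_in frame_mul // -tag_eqE /tag_eq /= eqxx tagged_asE /=.
    by case: ifP => // _; rewrite prod_inj0.
  rewrite prod_inj_out ?mulr0 ?prod_inj0 1?eq_sym // ifN //.
  by apply: contraNneq ij => /(congr1 tag) /= <-.
- rewrite -(sum_prod_inj 1) [RHS](eq_bigr (fun i => \sum_k prod_inj (e i k))).
    by rewrite sig_big_dep /=; apply: eq_bigr => -[].
  move=> i _; rewrite ffunE -(frame_sum (fr i)).
  exact: (big_morph _ (@prod_injD _ _ i) (prod_inj0 _ i)).
- have [ij|ij] := eqVneq i j; last first.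
    by rewrite !prod_inj_mulr prod_inj_out 1?eq_sym // mulr0 prod_inj0 eqxx.
  subst j; rewrite !prod_inj_mulr prod_inj_in prod_inj_eq0 => /(frame_inv (fr i)).
  move=> [t [t1 t2]]; exists (prod_inj t).
  by rewrite !prod_inj_mulr !prod_inj_in t1 t2.
- case: (frame_corner (fr i) k) => [[x ex]|[ee ex]]; [left | right].
    by exists (prod_inj x); rewrite -prod_injD ex prod_inj0.
  rewrite -prod_injD ee; split=> // x; rewrite !prod_inj_mulr prod_inj_in.
  by case: (ex (x i)) => ->; [left; rewrite prod_inj0 | right].
Qed.

(** These are the conditions on a division frame whose only idempotent is [1]. Up to isomorphism
    they single out the Boolean semifield and the division rings ([bool_or_divisionP]), so both
    kinds of matrix factor can be treated at once. *)
Record bool_or_division (K : pzSemiRingType) : Prop := BoolOrDivision {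
  bod_neq0 : 1 != 0 :> K;
  bod_inv : forall x : K, x != 0 -> exists y, y * x = 1 /\ x * y = 1;
  bod_kind : (exists x : K, 1 + x = 0) \/
    1 + 1 = 1 :> K /\ forall x : K, x = 0 \/ x = 1
}.

Lemma has_division_frame_mx (K : pzSemiRingType) n :
  bool_or_division K -> has_division_frame 'M[K]_n.
Proof.
move=> [K0 KV KC]; exists 'I_n, (fun i => delta_mx i i).
(* Diagonal matrix units cut out single entries, so [frame_inv] and [frame_corner] reduce to the
   conditions on [K]. *)
have dE i j (A : 'M[K]_n) :
    delta_mx i i * A * delta_mx j j = A i j *: delta_mx i j.
  apply/matrixP=> k l; rewrite !mxE (bigD1 j) //= big1 ?addr0 => [|q qj].
    rewrite !mxE (bigD1 i) //= big1 ?addr0 => [|q qi].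
      rewrite !mxE !eqxx andbT /= .
      by case: (k == i); case: (l == j); rewrite ?(mul1r, mulr1, mul0r, mulr0).
    by rewrite mxE (negPf qi) andbF mul0r.
  by rewrite [delta_mx j j _ _]mxE (negPf qj) mulr0.
have dM i j k (a b : K) :
    a *: delta_mx i j * (b *: delta_mx j k) = (a * b) *: delta_mx i k :> 'M_n.
  apply/matrixP=> p q; rewrite !mxE (bigD1 j) //= big1 ?addr0 => [|r rj].
    rewrite !mxE !eqxx andbT /=.
    by case: (p == i); case: (q == k); rewrite ?(mulr1, mulr0, mul0r).
  by rewrite !mxE (negPf rj) andbF mulr0 mul0r.
split=> [i | i j | | i j A | i].
- apply: contraNneq K0 => /matrixP/(_ i i); rewrite !mxE !eqxx /=.
  by move/eqP.
- have [<-|ij] := eqVneq i j.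
    by rewrite -[delta_mx i i]scale1r dM mulr1.
  apply/matrixP=> k l; rewrite !mxE big1 // => q _; rewrite !mxE.
  have [->|] := eqVneq q i; last by rewrite andbF mul0r.
  by rewrite (negPf ij) mulr0.
- apply/matrixP=> k l; rewrite summxE !mxE (bigD1 k) //= big1 => [|i ik].
    by rewrite !mxE eqxx addr0 eq_sym.
  by rewrite mxE eq_sym (negPf ik).
- rewrite dE => nz; have /KV[t [t1 t2]] : A i j != 0.
    by apply: contraNneq nz => ->; rewrite scale0r.
  exists (t *: delta_mx j i); rewrite !dM t1 t2.
  by rewrite !scale1r.
- case: KC => [[x ex]|[ee ex]]; [left | right].
    exists (x *: delta_mx i i).
    by rewrite -{1}[delta_mx i i]scale1r -scalerDl ex scale0r.
  rewrite -{1 2 3}[delta_mx i i]scale1r -scalerDl ee; split=> // A; rewrite dE.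
  by case: (ex (A i i)) => ->; rewrite ?scale0r ?scale1r; [left | right].
Qed.

Lemma bool_or_division_boolean : bool_or_division boolean_semifield.
Proof.
split=> // [[] // _ | ]; first by exists true.
by right; split=> // -[]; [right | left].
Qed.

Lemma bool_or_division_ring (D : unitRingType) :
  division_ring D -> bool_or_division D.
Proof.
move=> DV; split=> [|x /DV x_unit|]; first exact: oner_neq0.
  by exists x^-1; rewrite mulVr ?mulrV.
by left; exists (-1); rewrite subrr.
Qed.

(** * Congruence-simple principal left ideals *)

Record left_congruence (S : pzSemiRingType) (E : S -> S -> Prop) : Prop :=
  LeftCongruence {
    left_congr_refl : forall x, E x x;
    left_congr_sym : forall x y, E x y -> E y x;
    left_congr_trans : forall x y z, E x y -> E y z -> E x z;
    left_congr_add : forall x y x' y', E x y -> E x' y' -> E (x + x') (y + y');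
    left_congr_mul : forall a x y, E x y -> E (a * x) (a * y)
  }.

(* For idempotent [e]: the left ideal [S * e] is congruence-simple or zero; its
   congruences are pulled back to [S] along [x |-> x * e]. *)
Definition left_simple (S : pzSemiRingType) (e : S) : Prop :=
  forall E : S -> S -> Prop, left_congruence E ->
    (forall x y, E (x * e) (y * e) -> x * e = y * e) \/
    (forall x y, E (x * e) (y * e)).

(** Right multiplication by [e] is a linear retraction of [S] onto [N], which is the left ideal
    generated by [e]. Congruences on [S] restrict to [N] along [val], and congruences on [N] pull
    back to [S] along the retraction [ins]. *)
Lemma congruence_simple_idempotent (S : pzSemiRingType)
    (N : submodClosed S^o) (e : S) :
    e * e = e -> (forall x : S, (x \in N) = (x * e == x)) ->
  congruence_simple (subsemimodule N) <-> e != 0 /\ left_simple e.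
Proof.
move=> ee NE.
have inN (x : S) : x * e \in N by rewrite NE -mulrA ee.
pose ins (x : S) : subsemimodule N := exist _ (x * e) (inN x).
have insD x y : ins (x + y) = ins x + ins y by apply: val_inj; exact: mulrDl.
have insM (a x : S) : ins (a * x) = a *: ins x.
  by apply: val_inj; rewrite /= -mulrA.
have insK (u : subsemimodule N) : ins (val u) = u.
  by apply: val_inj; apply/eqP; rewrite /= -NE; exact: valP.
split=> [[[z z0] simp] | [e0 simp]]; split.
- apply: contraNneq z0 => e0; rewrite -(insK z); apply/eqP/val_inj.
  by rewrite /= e0 mulr0.
- move=> E [Er Es Et ED EZ].
  pose E' (u v : subsemimodule N) := E (val u) (val v).
  have cE : congruence E'.
    split=> [u | u v | u v w | u v u' v' | a u v]; rewrite /E' /=.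
    + exact: Er.
    + exact: Es.
    + exact: Et.
    + exact: ED.
    + exact: EZ.
  case: (simp _ cE) => EE; [left=> x y | right=> x y].
    by have [+ _] := EE (ins x) (ins y) => /[apply] /(congr1 val).
  exact: EE (ins x) (ins y).
- exists (ins e); apply: contraNneq e0 => /(congr1 val) /=.
  by rewrite ee => ->.
- move=> E [Er Es Et ED EZ].
  pose E' (x y : S) := E (ins x) (ins y).
  have cE : left_congruence E'.
    split=> [u | u v | u v w | u v u' v' | a u v]; rewrite /E'.
    + exact: Er.
    + exact: Es.
    + exact: Et.
    + by rewrite !insD; exact: ED.
    + by rewrite !insM; exact: EZ.
  have insE x : ins (x * e) = ins x by apply: val_inj; rewrite /= -mulrA ee.
  case: (simp _ cE) => EE; [left=> u v | right=> u v].
    split=> [Euv | ->]; last exact: Er.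
    rewrite -(insK u) -(insK v); apply: val_inj; apply: EE.
    by rewrite /E' !insE !insK.
  by have := EE (val u) (val v); rewrite /E' !insE !insK.
Qed.

(** * Direct sums and orthogonal idempotents *)

Lemma sum_finsupp_subset (J : choiceType) (V : nmodType)
    (f : {fsfun J -> V with 0}) (A : {fset J}) :
  (finsupp f `<=` A)%fset -> \sum_(j <- finsupp f) f j = \sum_(j <- A) f j.
Proof.
by move=> fA; apply: big_fset_incl => // j _; rewrite memNfinsupp => /eqP.
Qed.

(** The idempotents are the components of [1]. Indexing them by the support of that decomposition
    makes the family finite, although [J] is arbitrary. *)
Lemma idempotents_of_semisimple (S : pzSemiRingType) :
  left_congruence_semisimple S ->
  exists (T : finType) (e : T -> S),
    [/\ forall i, e i != 0, forall i j, e i * e j = if i == j then e i else 0,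
        \sum_i e i = 1 & forall i, left_simple (e i)].
Proof.
move=> [J [N [simp ds]]]; have [f [[fN f1'] _]] := ds 1.
have f1 : \sum_(j <- finsupp f) f j = 1 :> S by rewrite [RHS]f1'.
(* An [x] in [N i] has two decompositions: [d], concentrated at [i], and [g], obtained by
   multiplying that of [1] by [x]. Uniqueness identifies them. *)
have key i (x : S) j : x \in N i -> x * f j = if i == j then x else 0.
  move=> xN; have [h [_ h_uniq]] := ds x.
  pose g : {fsfun J -> S^o with 0} := [fsfun k in finsupp f => x * f k].
  pose d : {fsfun J -> S^o with 0} := [fsfun k in [fset i]%fset => x].
  have gE k : g k = x * f k.
    by rewrite fsfun_fun; case: finsuppP => // _; rewrite mulr0.
  have dE k : d k = if i == k then x else 0.
    by rewrite fsfun_fun in_fset1 eq_sym.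
  have gsub : (finsupp g `<=` finsupp f)%fset.
    by apply/fsubsetP => k; apply: contraLR => kf; rewrite memNfinsupp gE
      fsfun_dflt // mulr0.
  have dsub : (finsupp d `<=` [fset i])%fset.
    apply/fsubsetP => k; apply: contraLR; rewrite in_fset1 eq_sym => /negPf ik.
    by rewrite memNfinsupp dE ik.
  rewrite -dE -gE -(h_uniq g) ?(h_uniq d) //; split.
  - move=> k; rewrite dE; case: eqP => [<- // | _]; exact: rpred0.
  - by rewrite (sum_finsupp_subset dsub) big_seq_fset1 dE eqxx.
  - by move=> k; rewrite gE; apply: (rpredZ (x : S)).
  - rewrite (sum_finsupp_subset gsub) -[LHS](mulr1 (x : S)) -f1 mulr_sumr.
    by apply: eq_bigr => k _; rewrite gE.
pose F (j : J) : S := f j.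
have eM (i j : finsupp f) : F (val i) * F (val j) = if i == j then F (val i) else 0.
  exact: key.
exists (finsupp f), (fun i => F (val i)).
have simp_e (i : finsupp f) : F (val i) != 0 /\ left_simple (F (val i)).
  have NE (x : S) : (x \in N (val i)) = (x * F (val i) == x).
    apply/idP/eqP => [/key -> | <-]; first by rewrite eqxx.
    by apply: (rpredZ (x : S)).
  have := eM i i; rewrite eqxx => ee.
  by case: (congruence_simple_idempotent ee NE) => + _; apply.
split=> // [i | | i]; first by case: (simp_e i).
- by rewrite -f1 big_seq_fsetE.
- by case: (simp_e i).
Qed.

Section PrincipalLeftIdeal.
Variables (S : pzSemiRingType) (e : S).

(** For idempotent [e] this is the left ideal generated by [e]. The fixed-point equation is a
    boolean test, unlike the existence of a left factor. *)
Definition left_corner : {pred S^o} := [pred x : S | x * e == x].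

Lemma left_corner_closed : GRing.subsemimod_closed left_corner.
Proof.
split; [split=> [|x y /eqP xe /eqP ye] | move=> a x /eqP xe]; apply/eqP.
- exact: mul0r.
- by rewrite [LHS]mulrDl xe ye.
- by rewrite -mulrA xe.
Qed.

HB.instance Definition _ :=
  GRing.isSubSemiModClosed.Build S S^o left_corner left_corner_closed.

End PrincipalLeftIdeal.

(** The components of [x] are the [x * e i]; right multiplication by [e i] extracts the component at
    [i] from any decomposition, whence uniqueness. *)
Lemma semisimple_of_idempotents (S : pzSemiRingType) (T : finType) (e : T -> S) :
    (forall i, e i != 0) -> (forall i j, e i * e j = if i == j then e i else 0) ->
    \sum_i e i = 1 -> (forall i, left_simple (e i)) ->
  left_congruence_semisimple S.
Proof.
move=> e0 eM e1 simp; exists T, (fun i => left_corner (e i) : submodClosed _).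
split=> [i | x].
  have ee : e i * e i = e i by rewrite eM eqxx.
  by apply: (proj2 (congruence_simple_idempotent ee _)).
have sumT (g : {fsfun T -> S^o with 0}) : \sum_(j <- finsupp g) g j = \sum_j g j.
  rewrite big_uniq ?fset_uniq // big_mkcond; apply: eq_bigr => j _ /=.
  by case: finsuppP.
pose f : {fsfun T -> S^o with 0} := [fsfun i in [fset i | i : T]%fset => x * e i].
have fE i : f i = x * e i by rewrite fsfun_fun inE.
exists f; split=> [|g [gN xE]].
  split=> [i|]; first by apply/eqP; rewrite fE -mulrA eM eqxx.
  by rewrite sumT (eq_bigr _ (fun i _ => fE i)) -mulr_sumr e1 mulr1.
have gK i : (g i : S) * e i = g i by apply/eqP; exact: gN.
have gM i j : (g i : S) * e j = if i == j then g i else 0.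
  rewrite -[LHS](congr1 ( *%R^~ (e j)) (gK i)) -mulrA eM.
  by case: eqP; rewrite ?mulr0.
apply/fsfunP => i; rewrite fE xE sumT mulr_suml (bigD1 i) //=.
rewrite [g i * e i]gK big1 ?addr0 // => j ji.
by rewrite [LHS]gM (negPf ji).
Qed.

(** * From congruence-simple left ideals to a division frame *)

Section SimpleIdempotents.
Variables (S : pzSemiRingType) (T : finType) (e : T -> S).
Hypothesis e_neq0 : forall i, e i != 0.
Hypothesis e_mul : forall i j, e i * e j = if i == j then e i else 0.
Hypothesis e_simple : forall i, left_simple (e i).

Let ee i : e i * e i = e i. Proof. by rewrite e_mul eqxx. Qed.

(** If the kernel congruence of right multiplication by [a] were universal, it would relate [1] and
    [0], giving [a = e i * a = 0]. *)
Lemma left_simple_mulI i j (x : S) : e i * x * e j != 0 ->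
  forall y z, y * (e i * x * e j) = z * (e i * x * e j) -> y * e i = z * e i.
Proof.
set a := e i * x * e j => a0.
have ea : e i * a = a by rewrite !mulrA ee.
pose E (y z : S) := y * a = z * a.
have cE : left_congruence E.
  split=> [y | y z | y z w | y z y' z' | b y z]; rewrite /E //.
  - by move=> ->.
  - by rewrite !mulrDl => -> ->.
  - by rewrite -!mulrA => ->.
case: (e_simple i cE) => EE y z yz.
  by apply: EE; rewrite /E -!mulrA ea.
by have /eqP := EE 1 0; rewrite -!mulrA ea mul1r mul0r (negPf a0).
Qed.

(** The Bourne congruence of [S * a] relates [a] to [0], so it cannot be the identity when [a] is
    nonzero. Being universal, it relates [e j] to [0]. *)
Lemma left_simple_bourne j (a : S) : a * e j = a -> a != 0 ->
  exists s t, e j + s * a = t * a.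
Proof.
move=> ae a0; pose E (y z : S) := exists s t : S, y + s * a = z + t * a.
have cE : left_congruence E.
  split=> [y | y z [s [t st]] | y z w [s [t st]] [s' [t' st']]
          | y z y' z' [s [t st]] [s' [t' st']] | b y z [s [t st]]].
  - by exists 0, 0.
  - by exists t, s.
  - exists (s + s'), (t' + t); rewrite !mulrDl !addrA st.
    by rewrite [LHS]addrAC st'.
  - by exists (s + s'), (t + t'); rewrite !mulrDl [LHS]addrACA [RHS]addrACA st st'.
  - by exists (b * s), (b * t); rewrite -!mulrA -!mulrDr st.
case: (e_simple j cE) => EE.
  case/eqP: a0; rewrite -ae -[RHS](mul0r (e j)); apply: EE.
  by exists 0, 1; rewrite ae !mul0r mul1r add0r addr0.
by have [s [t st]] := EE 1 0; exists s, t; rewrite mul1r mul0r add0r in st.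
Qed.

(** Two elements are related when they differ by an additively invertible one. If the relation is
    universal, relating [e i] to [0] yields a negative of [e i]; if it is the identity, an
    invertible [x * e i], being related to [0], vanishes. *)
Lemma left_simple_negative_or_zerosumfree i : (exists x, e i + x = 0) \/
  forall x y, x * e i + y * e i = 0 -> x * e i = 0.
Proof.
pose E (y z : S) := exists v w : S, v + w = 0 /\ y + v = z.
have cE : left_congruence E.
  split=> [y | y z [v [w [vw <-]]] | y z t [v [w [vw <-]]] [v' [w' [vw' <-]]]
          | y z y' z' [v [w [vw <-]]] [v' [w' [vw' <-]]] | b y z [v [w [vw <-]]]].
  - by exists 0, 0; rewrite !addr0.
  - by exists w, v; rewrite addrC vw -addrA vw addr0.
  - by exists (v + v'), (w + w'); rewrite addrACA vw vw' addr0 addrA.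
  - by exists (v + v'), (w + w'); rewrite addrACA vw vw' addr0 addrACA.
  - by exists (b * v), (b * w); rewrite -!mulrDr vw mulr0.
case: (e_simple i cE) => EE; [right=> x y xy | left].
  by rewrite -(EE 0 x) ?mul0r //; exists (x * e i), (y * e i); rewrite add0r.
by have [v [w [_ ev]]] := EE 1 0; exists v; rewrite mul1r mul0r in ev.
Qed.

(** Having equal left annihilators is compatible with addition because, in a zero-sum-free module, a
    sum is killed exactly when both terms are. This congruence separates [e i] from [0], as [s = 1]
    shows, so it is the identity. *)
Lemma left_simple_annihilator i :
    (forall x y, x * e i + y * e i = 0 -> x * e i = 0) ->
  forall x y, (forall s, s * x * e i = 0 <-> s * y * e i = 0) ->
  x * e i = y * e i.
Proof.
move=> zsf.
pose E (x y : S) := forall s : S, s * x * e i = 0 <-> s * y * e i = 0.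
have zsfE (s x y : S) :
    s * (x + y) * e i = 0 <-> s * x * e i = 0 /\ s * y * e i = 0.
  rewrite mulrDr mulrDl; split=> [xy | [-> ->]]; last exact: addr0.
  by split; [exact: zsf xy | rewrite addrC in xy; exact: zsf xy].
have cE : left_congruence E.
  split=> [// | x y xy s | x y z xy yz s | x y x' y' xy xy' s | b x y xy s].
  - by split=> /xy.
  - by split=> [/xy/yz | /yz/xy].
  - by split=> /zsfE[/xy ? /xy' ?]; apply/zsfE.
  - by rewrite [s * (b * x)]mulrA [s * (b * y)]mulrA; exact: xy.
case: (e_simple i cE) => EE x y xy.
  by apply: EE => s; rewrite -!mulrA ee !mulrA; exact: xy.
have [_] := EE 1 0 1; rewrite !mul1r !mul0r ee => e0.
by case/eqP: (e_neq0 i); apply: e0.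
Qed.

(** A nonzero element of the corner has the same left annihilator as [e i], since right
    multiplication by it is injective on [S * e i]. *)
Lemma left_simple_boolean_corner i :
    (forall x y, x * e i + y * e i = 0 -> x * e i = 0) ->
  forall x, e i * x * e i = 0 \/ e i * x * e i = e i.
Proof.
move=> zsf x; have [-> | nz] := eqVneq (e i * x * e i) 0; [by left | right].
rewrite -[RHS]ee; apply: left_simple_annihilator => // s.
rewrite -(mulrA s (e i) (e i)) ee.
split=> s0; last by rewrite !mulrA s0 !mul0r.
rewrite -[RHS](mul0r (e i)); apply: (left_simple_mulI nz).
by rewrite mul0r -s0 !mulrA.
Qed.

(** The Bourne relation [e j + s * a = t * a] becomes a left inverse of [a] once [s * a] is disposed
    of: it is absorbed when [S * e j] is zero-sum-free, and subtracted when [e i] has a negative.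
    The remaining case is contradictory. *)
Lemma left_simple_inv i j (x : S) : e i * x * e j != 0 ->
  exists t, t * (e i * x * e j) = e j /\ e i * x * e j * t = e i.
Proof.
move=> nz; have mulI := left_simple_mulI nz.
set a := e i * x * e j in nz mulI *.
have ea : e i * a = a by rewrite !mulrA ee.
have ae : a * e j = a by rewrite /a -!mulrA ee.
clearbody a.
(* A left inverse suffices: it is also a right inverse, because right
   multiplication by [a] is injective on [S * e i]. *)
suff [t ta] : exists t, t * a = e j.
  exists (e j * t * e i); rewrite -!mulrA ea ta ee; split=> //.
  rewrite !mulrA ae -[RHS]ee; apply: mulI.
  by rewrite -mulrA ta ae ea.
have [s [t st]] := left_simple_bourne ae nz.
have [[n en] | zsf_j] := left_simple_negative_or_zerosumfree j; last first.
  (* [e_j + s a = t a], and [e_j t a] is [0] or [e_j]. *)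
  exists (e j * t); rewrite -mulrA.
  have := left_simple_boolean_corner zsf_j (t * a).
  rewrite -[e j * _ * e j]mulrA -[t * a * e j]mulrA ae; case=> // e0.
  have /zsf_j : e j * e j + e j * (s * a) * e j = 0.
    by rewrite -!mulrA ae -mulrDr st e0.
  by move/eqP; rewrite ee (negPf (e_neq0 j)).
have [[m em] | zsf_i] := left_simple_negative_or_zerosumfree i.
  (* Here [m] is a negative of [e i], so [s * m * a] cancels [s * a]. *)
  exists (t + s * m); rewrite mulrDl -st -addrA.
  have -> : s * a + s * m * a = s * ((e i + m) * a) by rewrite mulrDl mulrDr ea mulrA.
  by rewrite em mul0r mulr0 addr0.
(* [S e_i] is zero-sum-free and embeds in the module [S e_j]. *)
have an0 : a + a * n = 0 by rewrite -{1}ae -mulrDr en mulr0.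
exfalso; case/eqP: (nz).
(* Cancelling [a] on the right carries the Bourne relation over to [S * e i]. There the Boolean
   corner forces [a * t * e i = e i], which has the negative [a * n * t * e i], against
   zero-sum-freeness. *)
have ast : e i + a * s * e i = a * t * e i.
  suff : (e i + a * s) * e i = a * t * e i by rewrite mulrDl ee.
  by apply: mulI; rewrite mulrDl ea -!mulrA -st mulrDr ae.
have bc := left_simple_boolean_corner zsf_i.
have ate : a * t * e i = e i.
  have : a * t * e i = 0 \/ a * t * e i = e i.
    by rewrite -ea -mulrA; have := bc (a * t); rewrite !mulrA.
  case=> // at0; move: ast; rewrite at0 -{1}[e i]ee => /zsf_i.
  by rewrite ee => e0; case/eqP: (e_neq0 i).
have := zsf_i (a * t) (a * n * t); rewrite -mulrDl -mulrDl an0 !mul0r ate.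
by move=> /(_ erefl) e0; case/eqP: (e_neq0 i).
Qed.

Lemma division_frame_of_simple : \sum_i e i = 1 -> division_frame e.
Proof.
move=> e1; split=> // [i j x | i]; first exact: left_simple_inv.
have [|zsf] := left_simple_negative_or_zerosumfree i; first by left.
right; have bc := left_simple_boolean_corner zsf; split=> //.
(* The corner element of [1 + 1] is [e i + e i]; it cannot be [0] by zero-sum-freeness, so addition
   is idempotent. *)
have := bc (1 + 1); rewrite mulrDr mulrDl !mulr1 ee; case=> // e0.
have := zsf 1 1; rewrite !mul1r => /(_ e0) ei0.
by case/eqP: (e_neq0 i).
Qed.

End SimpleIdempotents.

(** A pair of distinct related elements differs in some component [k]. Multiplying by an inverse of
    that component relates [e i] to a corner element [b] other than [e i]. In the Boolean case
    [b = 0]; in the ring case [e i - b] is invertible and related to [0]. Either way [e i] is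
    related to [0]. *)
Lemma left_simple_of_division_frame (S : pzSemiRingType) (T : finType)
    (e : T -> S) i :
  division_frame e -> left_simple (e i).
Proof.
move=> [e0 eM e1 eV eC] E [Er Es Et ED EZ].
have ee k : e k * e k = e k by rewrite eM eqxx.
have [[x [y [Exy xy]]] | nE] := pselect (exists x y : S,
  E (x * e i) (y * e i) /\ x * e i <> y * e i); last first.
  left=> x y Exy; apply: contrapT => xy; apply: nE; by exists x, y.
right; suff E0 : E (e i) 0.
  move=> u v; apply: (@Et _ 0); last apply: Es.
    by have := EZ u _ _ E0; rewrite mulr0.
  by have := EZ v _ _ E0; rewrite mulr0.
have [k xyk] : exists k, e k * x * e i <> e k * y * e i.
  apply: contrapT => nk; apply: xy; rewrite -[x]mul1r -[y]mul1r -e1 !mulr_suml.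
  apply: eq_bigr => k _; apply: contrapT => xyk; apply: nk; by exists k.
(* The two components differ, so at least one is nonzero; the relation is symmetric. *)
wlog xk : x y Exy xy xyk / e k * x * e i != 0.
  move=> W; have [xk0 | ] := eqVneq (e k * x * e i) 0; last exact: (W x y).
  apply: (W y x) => //; [exact: Es | exact/nesym | exact/nesym |].
  by apply/eqP => yk0; apply: xyk; rewrite xk0 yk0.
have [t [t1 t2]] := eV _ _ _ xk.
have Ee : E (e i) (e i * (t * e k * y) * e i).
  have := EZ (e i * t * e k) _ _ Exy.
  rewrite (_ : e i * t * e k * (x * e i) = e i); last first.
    by rewrite -!mulrA (mulrA (e k)) t1 ee.
  by rewrite !mulrA.
set b := e i * (t * e k * y) * e i in Ee.
have bi : b <> e i.
  move=> be; apply: xyk; have := congr1 ( *%R (e k * x * e i)) be.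
  rewrite -[in RHS]mulrA ee => <-; rewrite /b !mulrA -(mulrA _ (e i) (e i)) ee t2.
  by rewrite ee.
case: (eC i) => [[m em] | [ei ex]]; last first.
  by case: (ex (t * e k * y)) => [b0 | /bi //]; rewrite /b b0 in Ee.
have eb : e i * b = b by rewrite /b !mulrA ee.
have be : b * e i = b by rewrite /b -!mulrA ee.
clearbody b.
(* The negative of [e i] inside the corner; [e i + m' * b] plays the part of [e i - b]. *)
pose m' := e i * m * e i.
have em' : e i + m' = 0.
  by rewrite -{1}[e i]ee -mulrDl -{1}[e i]ee -mulrDr em mulr0 mul0r.
have bm : b + m' * b = 0 by rewrite -{1}eb -mulrDl em' mul0r.
have E1 : E (e i + m' * b) 0 by rewrite -bm; exact: ED.
have cE : e i * (1 + m' * b) * e i = e i + m' * b.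
  by rewrite mulrDr mulr1 mulrDl ee -!mulrA be /m' !mulrA ee.
have c0 : e i * (1 + m' * b) * e i != 0.
  rewrite cE; apply/eqP => c0; apply: bi; rewrite -[LHS]addr0 -c0.
  by rewrite addrCA bm addr0.
have [s [s1 s2]] := eV _ _ _ c0.
by have := EZ s _ _ E1; rewrite -cE mulr0 s1.
Qed.

(** * Matrix decomposition *)

Section Corner.
Variables (S : pzSemiRingType) (e : S).
Hypothesis ee : e * e = e.

(* The idempotence proof is part of the type because the unit of the semiring
   structure on it depends on that proof. *)
Definition corner (_ : e * e = e) : Type := {x : S | e * x * e == x}.
Local Notation K := (corner ee).

HB.instance Definition _ := SubChoice.on K.

Lemma corner_subproof (x : S) : e * (e * x * e) * e == e * x * e.
Proof. by rewrite !mulrA ee -mulrA ee. Qed.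

Definition to_corner (x : S) : K :=
  exist _ (e * x * e) (corner_subproof x).

Lemma val_to_corner (x : S) : val (to_corner x) = e * x * e.
Proof. by []. Qed.

Lemma corner_idl (x : K) : e * val x = val x.
Proof. by have /eqP <- := valP x; rewrite !mulrA ee. Qed.

Lemma corner_idr (x : K) : val x * e = val x.
Proof. by have /eqP <- := valP x; rewrite -!mulrA ee. Qed.

Definition corner_add (x y : K) := to_corner (val x + val y).
Definition corner_mul (x y : K) := to_corner (val x * val y).

Let addE x y : val (corner_add x y) = val x + val y.
Proof. by rewrite val_to_corner mulrDr mulrDl !corner_idl !corner_idr. Qed.
Let mulE x y : val (corner_mul x y) = val x * val y.
Proof. by rewrite val_to_corner mulrA corner_idl -mulrA corner_idr. Qed.
Let zeroE : val (to_corner 0) = 0.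
Proof. by rewrite val_to_corner mulr0 mul0r. Qed.
Let oneE : val (to_corner 1) = e.
Proof. by rewrite val_to_corner mulr1 ee. Qed.

Lemma corner_addA : associative corner_add.
Proof. by move=> x y z; apply: val_inj; rewrite !addE addrA. Qed.
Lemma corner_addC : commutative corner_add.
Proof. by move=> x y; apply: val_inj; rewrite !addE addrC. Qed.
Lemma corner_add0 : left_id (to_corner 0) corner_add.
Proof. by move=> x; apply: val_inj; rewrite !addE zeroE add0r. Qed.
HB.instance Definition _ :=
  GRing.isNmodule.Build K corner_addA corner_addC corner_add0.

Lemma corner_mulA : associative corner_mul.
Proof. by move=> x y z; apply: val_inj; rewrite !mulE mulrA. Qed.
Lemma corner_mul1l : left_id (to_corner 1) corner_mul.
Proof. by move=> x; apply: val_inj; rewrite !mulE oneE corner_idl. Qed.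
Lemma corner_mul1r : right_id (to_corner 1) corner_mul.
Proof. by move=> x; apply: val_inj; rewrite !mulE oneE corner_idr. Qed.
Lemma corner_mulDl : left_distributive corner_mul corner_add.
Proof. by move=> x y z; apply: val_inj; rewrite !(addE, mulE) mulrDl. Qed.
Lemma corner_mulDr : right_distributive corner_mul corner_add.
Proof. by move=> x y z; apply: val_inj; rewrite !(addE, mulE) mulrDr. Qed.
Lemma corner_mul0l : left_zero (to_corner 0) corner_mul.
Proof. by move=> x; apply: val_inj; rewrite !mulE zeroE mul0r. Qed.
Lemma corner_mul0r : right_zero (to_corner 0) corner_mul.
Proof. by move=> x; apply: val_inj; rewrite !mulE zeroE mulr0. Qed.
HB.instance Definition _ :=
  GRing.Nmodule_isPzSemiRing.Build K corner_mulA corner_mul1l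
    corner_mul1r corner_mulDl corner_mulDr corner_mul0l corner_mul0r.

Lemma val_cornerD (x y : K) : val (x + y) = val x + val y.
Proof. exact: addE. Qed.
Lemma val_cornerM (x y : K) : val (x * y) = val x * val y.
Proof. exact: mulE. Qed.
Lemma val_corner0 : val (0 : K) = 0.
Proof. exact: zeroE. Qed.
Lemma val_corner1 : val (1 : K) = e.
Proof. exact: oneE. Qed.

End Corner.

(** * Recognising the Boolean semifield and division rings *)

Section DivisionRingOfSemiring.
Variable K : pzSemiRingType.
Hypothesis K_bod : bool_or_division K.
Hypothesis K_neg : exists x : K, 1 + x = 0.

(* An alias of [K], to carry the opposite and inverse given by the hypotheses. *)
Definition division_carrier (_ : bool_or_division K)
  (_ : exists x : K, 1 + x = 0) : Type := K.
Local Notation D := (division_carrier K_bod K_neg).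
HB.instance Definition _ := GRing.PzSemiRing.on D.

Definition division_opp (x : D) : D := (sval (cid K_neg) : D) * x.

Lemma division_addN : left_inverse 0 division_opp +%R.
Proof.
move=> x; rewrite addrC /division_opp -{1}[x]mul1r -mulrDl.
by rewrite [1 + _](svalP (cid K_neg)) mul0r.
Qed.

HB.instance Definition _ := GRing.Nmodule_isZmodule.Build D division_addN.
HB.instance Definition _ := GRing.PzSemiRing_isNonZero.Build D (bod_neq0 K_bod).

Definition division_inv (x : D) : D :=
  if pselect (x != 0) is left x0 then sval (cid (bod_inv K_bod x0)) else x.

Lemma division_invE (x : D) : x != 0 ->
  division_inv x * x = 1 /\ x * division_inv x = 1.
Proof.
by rewrite /division_inv; case: pselect => // x0 _; exact: svalP (cid (bod_inv K_bod x0)).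
Qed.

Lemma division_mulVx : {in predC1 (0 : D), left_inverse 1 division_inv *%R}.
Proof. by move=> x; rewrite inE => /division_invE[]. Qed.
Lemma division_mulxV : {in predC1 (0 : D), right_inverse 1 division_inv *%R}.
Proof. by move=> x; rewrite inE => /division_invE[]. Qed.
Lemma division_unitP (x y : D) : y * x = 1 /\ x * y = 1 -> predC1 (0 : D) x.
Proof.
move=> [yx _]; apply/eqP => x0; move: yx; rewrite x0 mulr0 => /esym/eqP.
by rewrite oner_eq0.
Qed.
Lemma division_inv_out : {in [predC predC1 (0 : D)], division_inv =1 id}.
Proof.
by move=> x; rewrite !inE negbK /division_inv => x0; case: pselect => // /negP[].
Qed.

HB.instance Definition _ := GRing.NzRing_hasMulInverse.Build D
  division_mulVx division_mulxV division_unitP division_inv_out.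

Lemma division_ring_of_semiring :
  exists2 D : unitRingType, division_ring D & semiring_isomorphic K D.
Proof.
(* The units of [D] were declared to be the nonzero elements. *)
exists D; first by move=> x.
by apply: (@semiring_isomorphicI K D id) => // x; exists x.
Qed.

End DivisionRingOfSemiring.

Lemma bool_or_divisionP (K : pzSemiRingType) : bool_or_division K ->
  semiring_isomorphic K boolean_semifield \/
  exists2 D : unitRingType, division_ring D & semiring_isomorphic K D.
Proof.
move=> K_bod; case: (bod_kind K_bod) => [K_neg | [K11 K01]].
  by right; exact: division_ring_of_semiring.
left; have K0 := bod_neq0 K_bod.
apply: (@semiring_isomorphicI K boolean_semifield (fun x => x != 0)).
- by rewrite eqxx.
- exact: K0.
- by move=> x y; case: (K01 x) => ->; case: (K01 y) => ->;
    rewrite ?addr0 ?add0r ?K11 ?eqxx ?K0.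
- by move=> x y; case: (K01 x) => ->; case: (K01 y) => ->;
    rewrite ?mulr0 ?mul0r ?mulr1 ?eqxx ?K0.
- by move=> x y; case: (K01 x) => ->; case: (K01 y) => ->; rewrite // eqxx (negPf K0).
- by case; [exists 1; exact: K0 | exists 0; rewrite eqxx].
Qed.

(** * Linked indices and matrix coordinates *)

Section FrameStructure.
Variables (S : pzSemiRingType) (T : finType) (e : T -> S).
Hypothesis fr : division_frame e.

Let ee i : e i * e i = e i. Proof. by rewrite (frame_mul fr) eqxx. Qed.

Definition linked i j : bool := `[< exists x, e i * x * e j != 0 >].

(** By [frame_inv], a nonzero element between [e i] and [e j] has an inverse; cutting this down to
    [e j * t * e i] makes the two idempotents equivalent. *)
Lemma linkedP i j : reflect
  (exists u v, [/\ e i * u * e j = u, e j * v * e i = v, u * v = e i & v * u = e j])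
  (linked i j).
Proof.
apply: (iffP (asboolP _)) => [[x nz] | [u [v [uE vE uv vu]]]]; last first.
  exists u; rewrite uE; apply/eqP => u0; case/eqP: (frame_neq0 fr i).
  by rewrite -uv u0 mul0r.
have [t [t1 t2]] := frame_inv fr nz; set a := e i * x * e j in nz t1 t2.
have ea : e i * a = a by rewrite /a !mulrA ee.
have ae : a * e j = a by rewrite /a -!mulrA ee.
clearbody a; exists a, (e j * t * e i); rewrite ea ae; split=> //.
- by rewrite !mulrA ee -mulrA ee.
- by rewrite !mulrA ae t2 ee.
- by rewrite -!mulrA ea t1 ee.
Qed.

Lemma linked_refl : reflexive linked.
Proof. by move=> i; apply/linkedP; exists (e i), (e i); rewrite !ee. Qed.

Lemma linked_sym : symmetric linked.
Proof.
suff H i j : linked i j -> linked j i by move=> i j; apply/idP/idP; exact: H.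
by move=> /linkedP[u [v [uE vE uv vu]]]; apply/linkedP; exists v, u.
Qed.

Lemma linked_trans : transitive linked.
Proof.
move=> j i k /linkedP[u [v [uE vE uv vu]]] /linkedP[u' [v' [uE' vE' uv' vu']]].
have idem_l a b x y : e a * x * e b = y -> e a * y = y.
  by move=> <-; rewrite !mulrA ee.
have idem_r a b x y : e a * x * e b = y -> y * e b = y.
  by move=> <-; rewrite -!mulrA ee.
apply/linkedP; exists (u * u'), (v' * v); split.
- by rewrite !mulrA (idem_l _ _ _ _ uE) -mulrA (idem_r _ _ _ _ uE').
- by rewrite !mulrA (idem_l _ _ _ _ vE') -mulrA (idem_r _ _ _ _ vE).
- by rewrite mulrA -(mulrA u) uv' (idem_r _ _ _ _ uE).
- by rewrite mulrA -(mulrA v') vu (idem_r _ _ _ _ vE').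
Qed.

(** [choose] depends only on the extension of the predicate, so all indices of a class receive the
    same representative. *)
Definition rep i : T := choose (linked i) i.

Lemma linked_rep i : linked (rep i) i.
Proof. by rewrite linked_sym; apply: chooseP; exact: linked_refl. Qed.

Lemma rep_eq i j : linked i j = (rep i == rep j).
Proof.
apply/idP/eqP => [ij | eq_rep].
  have E : linked i =1 linked j.
    move=> k; apply/idP/idP; apply: linked_trans => //; by rewrite linked_sym.
  by rewrite /rep -(eq_choose E); apply: choose_id => //; exact: linked_refl.
by apply: linked_trans (linked_rep j); rewrite -eq_rep linked_sym linked_rep.
Qed.

Lemma rep_id i : rep (rep i) = rep i.
Proof. by apply/eqP; rewrite -rep_eq linked_rep. Qed.

(** Fixes for each [i] mutually inverse elements [u i] and [v i] linking [e (rep i)] and [e i].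
    Within a class, the products [v i * u j] behave as matrix units. *)
Let uv_ex i := cid (linkedP _ _ (linked_rep i)).
Let u i := sval (uv_ex i).
Let v_ex i := cid (svalP (uv_ex i)).
Let v i := sval (v_ex i).
Let uvP i : [/\ e (rep i) * u i * e i = u i, e i * v i * e (rep i) = v i,
  u i * v i = e (rep i) & v i * u i = e i] := svalP (v_ex i).

Let uE i : u i * e i = u i.
Proof. by have [<- _ _ _] := uvP i; rewrite -mulrA ee. Qed.
Let eu i : e (rep i) * u i = u i.
Proof. by have [<- _ _ _] := uvP i; rewrite !mulrA ee. Qed.
Let vE i : v i * e (rep i) = v i.
Proof. by have [_ <- _ _] := uvP i; rewrite -mulrA ee. Qed.
Let ev i : e i * v i = v i.
Proof. by have [_ <- _ _] := uvP i; rewrite !mulrA ee. Qed.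
Let uv i j : u i * v j = if i == j then e (rep i) else 0.
Proof.
rewrite -uE -ev -mulrA (mulrA (e i)) (frame_mul fr).
case: eqP => [<-|_]; last by rewrite mul0r mulr0.
by rewrite ev; case: (uvP i).
Qed.
Let vu i : v i * u i = e i.
Proof. by case: (uvP i). Qed.

Definition frame_class : finType := {c : T | rep c == c}.
Definition frame_fiber (c : frame_class) : {set T} := [set i | rep i == val c].
Definition frame_ring (c : frame_class) : pzSemiRingType := corner (ee (val c)).

Lemma frame_ring_bod c : bool_or_division (frame_ring c).
Proof.
set i := val c; split=> [|x x0|].
- apply: contraNneq (frame_neq0 fr i) => /(congr1 val).
  by rewrite val_corner1 val_corner0 => ->.
- have xE : e i * val x * e i = val x by apply/eqP; exact: valP x.
  have nz : e i * val x * e i != 0.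
    rewrite xE; apply: contraNneq x0 => vx0; apply/eqP/val_inj.
    by rewrite val_corner0.
  have [t] := frame_inv fr nz; rewrite xE => -[t1 t2]; exists (to_corner (ee i) t).
  split; apply: val_inj; rewrite val_cornerM val_corner1 val_to_corner.
    by rewrite -!mulrA corner_idl t1 ee.
  by rewrite !mulrA corner_idr t2 ee.
- case: (frame_corner fr i) => [[x ex] | [eD ex]]; [left | right].
    exists (to_corner (ee i) x); apply: val_inj.
    rewrite val_cornerD val_corner1 val_corner0 val_to_corner.
    by rewrite -{1}[e i]ee -mulrDl -{1}[e i]ee -mulrDr ex mulr0 mul0r.
  split=> [|x]; first by apply: val_inj; rewrite val_cornerD val_corner1.
  have xE : e i * val x * e i = val x by apply/eqP; exact: valP x.
  case: (ex (val x)); rewrite xE => xi; [left | right]; apply: val_inj.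
    by rewrite xi val_corner0.
  by rewrite xi val_corner1.
Qed.

Let idx (c : frame_class) : 'I_#|frame_fiber c| -> T := enum_val.

Let rep_idx c p : rep (@idx c p) = val c.
Proof. by apply/eqP; have := enum_valP p; rewrite inE. Qed.

(** The block of [s] between [e i] and [e j] is transported by [u] and [v] to the corner at the
    representative, so that all entries lie in one semiring. *)
Definition frame_coord (s : S) :
    prod_semiring (fun c => 'M[frame_ring c]_#|frame_fiber c|) :=
  [ffun c => \matrix_(p, q) to_corner (ee (val c)) (u (idx p) * s * v (idx q))].

Let val_coord s c p q :
  val (frame_coord s c p q) = u (@idx c p) * s * v (@idx c q).
Proof.
rewrite ffunE mxE val_to_corner -{1}(rep_idx p) -(rep_idx q) !mulrA eu.
by rewrite -!mulrA vE.
Qed.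

Let coord_inj : injective frame_coord.
Proof.
move=> s t st; rewrite -[s]mul1r -[s]mulr1 -[t]mul1r -[t]mulr1.
rewrite -(frame_sum fr) !mulr_suml; apply: eq_bigr => i _.
rewrite !mulr_sumr; apply: eq_bigr => j _; rewrite !mulrA.
(* Between unlinked indices both blocks vanish; between linked ones the block of [s] is recovered as
   [v i * (u i * s * v j) * u j]. *)
have [ij | ij] := eqVneq (rep i) (rep j); last first.
  move: ij; rewrite -rep_eq; apply: contraNeq => nz; apply/asboolP.
  case: (eqVneq (e i * s * e j) 0) nz => [-> nz | nz _]; last by exists s.
  by exists t; rewrite eq_sym.
pose c : frame_class := exist _ (rep i) (introT eqP (rep_id i)).
have ic : i \in frame_fiber c by rewrite inE.
have jc : j \in frame_fiber c by rewrite inE -ij.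
have := val_coord s (enum_rank_in ic i) (enum_rank_in jc j).
rewrite st val_coord /idx !enum_rankK_in // => E.
by rewrite -(vu i) -(vu j) !mulrA -!(mulrA (v i)) E.
Qed.

Let coord_surj A : exists s, frame_coord s = A.
Proof.
(* The inverse transport of the entries; [u i * v j = 0] for [i != j] then isolates each entry. *)
exists (\sum_c \sum_p \sum_q v (@idx c p) * val (A c p q) * u (@idx c q)).
apply/ffunP => c; apply/matrixP => p q; apply: val_inj; rewrite val_coord.
have idx_neq d d' (r : 'I_#|frame_fiber d|) (r' : 'I_#|frame_fiber d'|) :
    d != d' -> idx r != idx r'.
  by apply: contraNneq => /(congr1 rep); rewrite !rep_idx => /val_inj ->.
have idx_inj d (r r' : 'I_#|frame_fiber d|) : (idx r == idx r') = (r == r').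
  by rewrite (inj_eq enum_val_inj).
rewrite mulr_sumr mulr_suml (bigD1 c) //= [X in _ + X]big1 ?addr0 => [|d dc].
  rewrite mulr_sumr mulr_suml (bigD1 p) //= [X in _ + X]big1 ?addr0 => [|r rp].
    rewrite mulr_sumr mulr_suml (bigD1 q) //= [X in _ + X]big1 ?addr0 => [|r rq].
      rewrite !mulrA uv eqxx -!mulrA uv eqxx !rep_idx.
      by rewrite corner_idr corner_idl.
    by rewrite -!mulrA uv idx_inj (negPf rq) !mulr0.
  rewrite mulr_sumr mulr_suml big1 // => r' _.
  by rewrite !mulrA uv idx_inj eq_sym (negPf rp) !mul0r.
rewrite mulr_sumr mulr_suml big1 // => r _.
rewrite mulr_sumr mulr_suml big1 // => r' _.
by rewrite !mulrA uv (negPf (idx_neq _ _ _ _ _)) ?mul0r // eq_sym.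
Qed.

Lemma frame_structure : semiring_isomorphic S
  (prod_semiring (fun c => 'M[frame_ring c]_#|frame_fiber c|)).
Proof.
have valD c (x y : frame_ring c) : val (x + y) = val x + val y.
  exact: val_cornerD.
apply: (@semiring_isomorphicI _ _ frame_coord) => // [| | s t | s t].
- apply/ffunP => c; apply/matrixP => p q; apply: val_inj; rewrite val_coord.
  by rewrite ffunE mxE val_corner0 mulr0 mul0r.
- apply/ffunP => c; apply/matrixP => p q; apply: val_inj; rewrite val_coord.
  rewrite ffunE mxE mulr1 uv (inj_eq enum_val_inj) rep_idx.
  by case: eqP => _; rewrite ?val_corner1 ?val_corner0.
- apply/ffunP => c; apply/matrixP => p q; apply: val_inj.
  by rewrite [in RHS]ffunE mxE valD !val_coord mulrDr mulrDl.
- apply/ffunP => c; apply/matrixP => p q; apply: val_inj.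
  rewrite [in RHS]ffunE mxE (big_morph val (@valD c) (val_corner0 _)).
  (* Inserting [1], the sum of the [e i], between [s] and [t] gives the matrix product: terms
     outside the class vanish, and inside it [e i = v i * u i]. *)
  rewrite val_coord -[s * t](congr1 ( *%R^~ t) (mulr1 s)) -(frame_sum fr).
  rewrite mulr_sumr !(mulr_suml, mulr_sumr) (bigID (mem (frame_fiber c))) /=.
  rewrite [X in _ + X]big1 ?addr0 => [|i]; last first.
    rewrite inE -(rep_idx p) => ri.
    suff us0 : u (idx p) * s * e i = 0 by rewrite mulrA mulrA us0 !mul0r.
    move: ri; rewrite eq_sym -rep_eq; apply: contraNeq => nz; apply/asboolP.
    exists s; apply: contraNneq nz => s0.
    by rewrite -uE -!mulrA (mulrA (e _)) s0 mulr0.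
  rewrite big_enum_val; apply: eq_bigr => r _.
  by rewrite [RHS]val_cornerM !val_coord -(vu (enum_val r)) !mulrA.
Qed.

End FrameStructure.

(** * The equivalence of the three conditions *)

Definition matrix_decomposition (S : pzSemiRingType) : Prop :=
  exists (k r : nat) (n : 'I_k -> nat) (m : 'I_r -> nat)
         (D : 'I_r -> unitRingType),
    [/\ forall i, (0 < n i)%N, forall j, (0 < m j)%N,
        forall j, division_ring (D j)
      & semiring_isomorphic S
          (prod_semiring (fun i => 'M[boolean_semifield]_(n i)) *
           prod_semiring (fun j => 'M[D j]_(m j)))%type].

Lemma matrix_decomposition_of_frame (S : pzSemiRingType) :
  has_division_frame S -> matrix_decomposition S.
Proof.
move=> [T [e fr]]; pose C := frame_class e.
pose K (c : C) := frame_ring fr c; pose n (c : C) := #|frame_fiber c|.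
have n_gt0 c : (0 < n c)%N.
  apply/card_gt0P; exists (val c); rewrite inE; exact: valP c.
(* Classes with Boolean corner supply the first product; by [bool_or_divisionP] the others have
   division rings as corners. *)
pose A := [set c : C | `[< semiring_isomorphic (K c) boolean_semifield >]].
have B_iso (i : 'I_#|A|) : semiring_isomorphic (K (enum_val i)) boolean_semifield.
  by have := enum_valP i; rewrite inE => /asboolP.
have D_ex (j : 'I_#|~: A|) : exists2 D : unitRingType,
    division_ring D & semiring_isomorphic (K (enum_val j)) D.
  have := enum_valP j; rewrite !inE => /asboolP nb.
  by case: (bool_or_divisionP (frame_ring_bod fr (enum_val j))) => [/nb|].
pose D j := s2val (cid2 (D_ex j)).
pose h (i : 'I_#|A| + 'I_#|~: A|) : C :=
  match i with inl i => enum_val i | inr j => enum_val j end.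
have h_bij : bijective h.
  apply: inj_card_bij => [[] i [] j /= ij|].
  - by rewrite (enum_val_inj ij).
  - by have := enum_valP j; rewrite -ij in_setC enum_valP.
  - by have := enum_valP i; rewrite ij in_setC enum_valP.
  - by rewrite (enum_val_inj ij).
  - by rewrite card_sum !card_ord cardsC.
exists #|A|, #|~: A|, (fun i => n (enum_val i)), (fun j => n (enum_val j)), D.
split=> // [j|]; first exact: s2valP (cid2 (D_ex j)).
apply: semiring_isomorphic_trans (frame_structure fr) _.
apply: (semiring_isomorphic_prod h_bij) => [i | j] /=; apply: semiring_isomorphic_mx.
  exact: B_iso.
exact: s2valP' (cid2 (D_ex j)).
Qed.

Lemma frame_of_matrix_decomposition (S : pzSemiRingType) :
  matrix_decomposition S -> has_division_frame S.
Proof.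
move=> [k [r [n [m [D [_ _ DV S_iso]]]]]].
apply: has_division_frame_iso (semiring_isomorphic_sym S_iso) _.
apply: has_division_frame_pair; apply: has_division_frame_prod => i.
  exact/has_division_frame_mx/bool_or_division_boolean.
exact/has_division_frame_mx/bool_or_division_ring.
Qed.

Lemma left_congruence_semisimpleP (S : pzSemiRingType) :
  left_congruence_semisimple S <-> has_division_frame S.
Proof.
split=> [/idempotents_of_semisimple[T [e [e0 eM e1 simp]]] | [T [e fr]]].
  by exists T, e; exact: division_frame_of_simple.
apply: (@semisimple_of_idempotents S T e); [exact: frame_neq0 fr |
  exact: frame_mul fr | exact: frame_sum fr |].
by move=> i; exact: left_simple_of_division_frame.
Qed.

Lemma right_congruence_semisimpleP (S : pzSemiRingType) :
  right_congruence_semisimple S <-> has_division_frame S.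
Proof.
rewrite -[right_congruence_semisimple S]/(left_congruence_semisimple S^c).
split=> [/left_congruence_semisimpleP/has_division_frame_converse | ].
  (* This frame lives over the double opposite, whose operations unfold to those of [S]; its fields
     are repacked over [S]. *)
  move=> [T [e fr]]; exists T, e.
  by case: fr => e0 eM e1 eV eC; split.
by move=> /has_division_frame_converse/left_congruence_semisimpleP.
Qed.

Theorem theorem3p4 (S : pzSemiRingType) :
  [<-> right_congruence_semisimple S;
       exists (k r : nat) (n : 'I_k -> nat) (m : 'I_r -> nat)
              (D : 'I_r -> unitRingType),
         [/\ forall i, (0 < n i)%N, forall j, (0 < m j)%N,
             forall j, division_ring (D j)
           & semiring_isomorphic S
               (prod_semiring (fun i => 'M[boolean_semifield]_(n i)) *
                prod_semiring (fun j => 'M[D j]_(m j)))%type];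
       left_congruence_semisimple S].
Proof.
tfae.
- by move=> /right_congruence_semisimpleP; exact: matrix_decomposition_of_frame.
- by move=> /frame_of_matrix_decomposition/left_congruence_semisimpleP.
- by move=> /left_congruence_semisimpleP/right_congruence_semisimpleP.
Qed.
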